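(* Let $\alpha$ be a Pisot number and let $\lambda=\alpha^{-1}$. Let $\mu_{\lambda,B}$ be the Hutchinson measure on $\mathbb{R}^2$ of the IFS $\{\tau_b(x)=\lambda(x+b)\}_{b\in B}$ with $B=\{[0,0]^t,[1,0]^t,[0,1]^t\}$ and equal weights $1/3$, and for $\xi\in\mathbb{R}$ put $$\hat\mu_{\lambda,B,W}(\xi)=\hat\mu_{\lambda,B}([\xi,\xi]^t)=\prod_{n=1}^\infty \frac13\bigl(1+2e^{i2\pi\lambda^n\xi}\bigr).$$ Then there exists a constant $C>0$ such that $|\hat\mu_{\lambda,B,W}(\alpha^k)|\ge C$ for all integers $k\ge 0$; as a result, the sequence $\{|\hat\mu_{\lambda,B,W}(\alpha^k)|\}_{k=0}^\infty$ does not tend to $0$ as $k\to\infty$.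
   Context: A Pisot number is an algebraic integer $\alpha>1$ (real) all of whose Galois conjugates other than $\alpha$ itself have modulus less than $1$. The Hutchinson measure of the contractive affine IFS $\{\tau_b\}_{b\in B}$ with equal weights is the unique Borel probability measure $\mu$ on $\mathbb{R}^2$ satisfying $\mu=\frac{1}{\#B}\sum_{b\in B}\mu\circ\tau_b^{-1}$. The Fourier transform is $\hat\mu(\xi)=\int e^{i2\pi\xi\cdot x}\,d\mu(x)$. *)

(* Defs.v *)
From HB Require Import structures.
From mathcomp Require Import all_boot all_order all_algebra.
From mathcomp Require Import complex.
From mathcomp Require Import all_classical all_reals all_analysis.

Set Implicit Arguments.
Unset Strict Implicit.
Unset Printing Implicit Defensive.

Import Order.TTheory GRing.Theory Num.Theory.
Import numFieldNormedType.Exports.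

Local Open Scope classical_set_scope.
Local Open Scope complex_scope.
Local Open Scope ring_scope.

(* The modulus of a complex number, as an element of R; the norm [`|z|] of the
   numClosedFieldType R[i] takes its values in R[i] itself. *)
Definition cmod (R : realType) (z : R[i]) : R := ComplexField.Normc.normc z.

Definition min_poly_over_rat (R : realType) (a : R) (p : {poly rat}) : Prop :=
  [/\ p \is monic, irreducible_poly p & root (map_poly ratr p) a].

Definition galois_conjugate (R : realType) (a : R) (z : R[i]) : Prop :=
  exists2 p : {poly rat}, min_poly_over_rat a p & root (map_poly ratr p) z.

Definition pisot (R : realType) (a : R) : Prop :=
  [/\ 1 < a, integralOver (intr : int -> R) a &
      forall z : R[i], galois_conjugate a z -> z != a%:C -> cmod z < 1].

(* e^{it} *)
Definition cexpi (R : realType) (t : R) : R[i] := cos t +i* sin t.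

Definition Cintegral (R : realType) (d : measure_display)
    (T : measurableType d) (mu : {measure set T -> \bar R})
    (f : T -> R[i]) : R[i] :=
  Rintegral mu setT (fun x => complex.Re (f x))
    +i* Rintegral mu setT (fun x => complex.Im (f x)).

Definition dot2 (R : realType) (x y : R * R) : R := x.1 * y.1 + x.2 * y.2.

(* The plane is R * R with the product of the Borel sigma-algebras of the two
   factors, which is the Borel sigma-algebra of the plane. *)
Definition fourier (R : realType) (mu : probability (R * R)%type R)
    (xi : R * R) : R[i] :=
  Cintegral mu (fun x : R * R => cexpi (2 * pi * dot2 xi x)).

Definition tau (R : realType) (lambda : R) (b x : R * R) : R * R :=
  (lambda * (x.1 + b.1), lambda * (x.2 + b.2)).

(* mu = (1 / #B) \sum_(b in B) mu \o tau_b^-1; B lists distinct digits. *)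
Definition hutchinson (R : realType) (lambda : R) (B : seq (R * R))
    (mu : probability (R * R)%type R) : Prop :=
  forall A : set (R * R), measurable A ->
    mu A = (((size B)%:R^-1)%:E
              * (\sum_(b <- B) mu (tau lambda b @^-1` A)))%E.

Definition sierpinski_digits (R : realType) : seq (R * R) :=
  [:: (0, 0); (1, 0); (0, 1)].

Definition fourier_diag (R : realType) (mu : probability (R * R)%type R)
    (xi : R) : R[i] :=
  fourier mu (xi, xi).

(* Main.v *)
Require Import Defs.
From HB Require Import structures.
From mathcomp Require Import all_boot all_order all_algebra.
From mathcomp Require Import separable ring lra zify.
From mathcomp Require Import complex.
From mathcomp Require Import all_classical all_reals all_analysis.
From mathcomp Require Import measurable_realfun.

Set Implicit Arguments.
Unset Strict Implicit.
Unset Printing Implicit Defensive.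

Import Order.TTheory GRing.Theory Num.Theory.
Import numFieldNormedType.Exports.

Local Open Scope classical_set_scope.
Local Open Scope complex_scope.
Local Open Scope ring_scope.

(* Self-similarity gives F(xi) = m(lambda xi) F(lambda xi) for the diagonal
   Fourier transform F and m(x) = (1 + 2 e^{2 i pi x}) / 3; since F is
   continuous at 0 with F(0) = 1, the product formula follows and F never
   vanishes (m does not). Hence |F(alpha^k)| is |F(1)| times the product of
   the |m(alpha^j)|, j < k. The powers of a Pisot number have summable
   distance to the integers, because the trace of alpha^j is an integer and
   the other conjugates decay geometrically; near an integer |m| is 1 up to a
   multiple of the distance, and |m| >= 1/3 everywhere, so the products are
   bounded below. *)

(** * Powers of Pisot numbers *)

(* From [P^`() / P = \sum_z 1 / ('X - z)] and
   ['X^m = ('X - z) * (\sum_(j < m) z ^+ j 'X^(m.-1 - j)) + z ^+ m]. *)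
Lemma Xn_deriv_prod_XsubC (L : comNzRingType) (rs : seq L) (m : nat) :
  let P := \prod_(z <- rs) ('X - z%:P) in
  exists2 r : {poly L}, (size r <= size rs)%N &
    'X^m * P^`() =
      P * \sum_(j < m) (\sum_(z <- rs) z ^+ j) *: 'X^(m.-1 - j) + r.
Proof.
elim: rs => [|z rs [r sr IH]] /=.
  exists 0; first by rewrite size_poly0.
  rewrite big_nil derivC mulr0 mul1r addr0 big1// => j _.
  by rewrite big_nil scale0r.
set P := \prod_(z <- rs) _ in IH *.
(* By the product rule the new root contributes ['X^m * P], which leaves [z ^+ m *: P]; the old
   remainder is multiplied by ['X - z%:P]. *)
exists (('X - z%:P) * r + z ^+ m *: P).
  apply: leq_trans (size_polyD _ _) _; rewrite geq_max; apply/andP; split.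
    by apply: leq_trans (size_polyMleq _ _) _; rewrite size_XsubC.
  apply: leq_trans (size_scale_leq _ _) _.
  by rewrite size_prod_XsubC.
have E : \sum_(j < m) (\sum_(y <- z :: rs) y ^+ j) *: 'X^(m.-1 - j) =
   \sum_(j < m) z ^+ j *: 'X^(m.-1 - j) +
   \sum_(j < m) (\sum_(y <- rs) y ^+ j) *: 'X^(m.-1 - j) :> {poly L}.
  by rewrite -big_split; apply: eq_bigr => j _; rewrite big_cons scalerDl.
rewrite E big_cons -/P derivM derivXsubC mul1r [in LHS]mulrDr.
rewrite (mulrCA 'X^m) IH.
have Z : 'X^m = ('X - z%:P) * (\sum_(j < m) z ^+ j *: 'X^(m.-1 - j))
               + (z ^+ m)%:P.
  rewrite polyC_exp -[LHS](subrK (z%:P ^+ m)) subrXX; congr (_ * _ + _).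
  by apply: eq_bigr => j _; rewrite -polyC_exp mulrC mul_polyC.
rewrite {1}Z -mul_polyC mulrDl !mulrDr.
set S1 := \sum_(j < m) _; set S2 := \sum_(j < m) _; set X := _ - _.
set W := (_ ^+ _)%:P.
ring.
Qed.

(* Comparing the constant coefficients of the quotients of ['X^(m.+1) * P^`()]
   by the monic polynomial [P], computed over the integers and over [L]. *)
Lemma int_power_sum (L : idomainType) (q : {poly int}) (rs : seq L) (m : nat) :
    q \is monic -> map_poly intr q = \prod_(z <- rs) ('X - z%:P) ->
  exists s : int, \sum_(z <- rs) z ^+ m = s%:~R.
Proof.
move=> mq; set P := \prod_(z <- rs) _ => qP.
have [r sr] := Xn_deriv_prod_XsubC rs m.+1; rewrite -/P /=.
set S := \sum_(j < _) _ => PS.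
have sP : size P = (size rs).+1 by rewrite size_prod_XsubC.
have mP : P \is monic by exact: monic_prod_XsubC.
set A := Pdiv.CommonRing.rdivp ('X^(m.+1) * q^`()) q.
set B := Pdiv.CommonRing.rmodp ('X^(m.+1) * q^`()) q.
have := Pdiv.RingMonic.rdivp_eq mq ('X^(m.+1) * q^`()); rewrite -/A -/B.
move=> /(congr1 (map_poly (intr : int -> L))).
rewrite rmorphD !rmorphM /= map_polyXn -deriv_map qP PS => E.
have q0 : q != 0 by rewrite monic_neq0.
have sB : (size (map_poly intr B : {poly L}) <= size rs)%N.
  apply: leq_trans (size_poly _ _) _.
  rewrite -ltnS -sP -qP size_map_poly_id0; last first.
    by rewrite (monicP mq) oner_eq0.
  by rewrite Pdiv.CommonRing.ltn_rmodp.
(* Uniqueness of division: if the quotients differed, [P] times their difference would have size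
   above [size rs], but it is a difference of two remainders. *)
have SA : S = map_poly intr A.
  apply/eqP; rewrite -subr_eq0; apply: contraT => nz.
  have : P * (S - map_poly intr A) = map_poly intr B - r.
    by apply/eqP; rewrite mulrBr (mulrC P (map_poly _ _)) subr_eq addrAC
      -subr_eq opprK (addrC (map_poly _ B)) E addrC.
  move=> /(congr1 (size : {poly L} -> nat)).
  rewrite (size_monicM mP nz) sP addSn /= => H.
  have : (size (map_poly intr B - r : {poly L})%R <= size rs)%N.
    by apply: leq_trans (size_polyD _ _) _; rewrite geq_max sB size_polyN.
  rewrite -H -{2}(addn0 (size rs)) leq_add2l leqn0 size_poly_eq0.
  by rewrite (negbTE nz).
(* With exponent [m.+1] the last index [j = m] carries ['X^0] and all others a positive power, so
   the constant coefficient of [S] is the [m]-th power sum. *)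
exists A`_0; rewrite -coef_map /= -SA coef_sum big_ord_recr /=.
rewrite subnn coefZ coefXn mulr1 [X in _ = X + _]big1 ?add0r// => j _.
by rewrite coefZ coefXn eq_sym subn_eq0 leqNgt ltn_ord mulr0.
Qed.

(** * Minimal polynomials of algebraic integers *)

Lemma map_poly_ratr_int (F : numFieldType) (q : {poly int}) :
  map_poly ratr (map_poly intr q : {poly rat}) = map_poly intr q :> {poly F}.
Proof.
by rewrite -map_poly_comp; apply: eq_map_poly => x /=; rewrite ratr_int.
Qed.

(** A rational polynomial of least size vanishing at [a] is irreducible and divides the monic
    integer polynomial [q0]; Gauss's lemma then makes it integral. *)
Lemma min_poly_exists (R : realType) (a : R) :
    integralOver (intr : int -> R) a ->
  exists2 q : {poly int}, q \is monic & min_poly_over_rat a (map_poly intr q).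
Proof.
move=> [q0 mq0 rq0].
pose Q (n : nat) := exists p : {poly rat},
  [/\ p != 0, root (map_poly ratr p) a & size p = n].
have mz (q : {poly int}) :
    q \is monic -> (map_poly intr q : {poly rat}) \is monic.
  exact: monic_map.
have exQ : exists n, `[< Q n >].
  exists (size (map_poly intr q0 : {poly rat})); apply/asboolP.
  exists (map_poly intr q0); split => //; last by rewrite map_poly_ratr_int.
  by rewrite monic_neq0// mz.
have [n /asboolP[p [p0 rp sp]] minn] := ex_minnP exQ.
have {}minn (g : {poly rat}) :
    g != 0 -> root (map_poly ratr g) a -> (size p <= size g)%N.
  by move=> g0 rg; rewrite sp; apply: minn; apply/asboolP; exists g.
have irr : irreducible_poly p.
  split.
    rewrite ltnNge; apply/negP => s1.
    move: rp p0; rewrite (size1_polyC s1) map_polyC /= rootC.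
    rewrite fmorph_eq0 => /eqP->.
    by rewrite polyC0 eqxx.
  (* In [p = h * g] with [g] nonconstant, [h] is too small to vanish at [a]; hence [g] vanishes
     there and has full size by minimality. *)
  move=> g sg gp; rewrite -dvdp_size_eqp// eqn_leq dvdp_leq//=.
  have [h ph] := dvdpP _ _ gp.
  move: p0 rp; rewrite ph mulf_eq0 negb_or rmorphM /= rootM.
  move=> /andP[h0 g0] /orP[rh|rg]; last first.
    by rewrite -ph; apply: minn.
  have := minn _ h0 rh; rewrite ph size_mul//.
  move: sg h0 g0; rewrite -!size_poly_gt0.
  by move: (size g) (size h) => k l; lia.
have pq : p %| map_poly intr q0.
  (* The gcd vanishes at [a], so it is nonconstant and therefore associated to the irreducible
     [p]. *)
  have : root (map_poly ratr (gcdp p (map_poly intr q0))) a.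
    by rewrite gcdp_map root_gcd rp map_poly_ratr_int.
  move=> rg.
  have g0 : gcdp p (map_poly intr q0) != 0 by rewrite gcdp_eq0 negb_and p0.
  rewrite -(eqp_dvdl _ (irr.2 _ _ (dvdp_gcdl p (map_poly intr q0))))
    ?dvdp_gcdr//.
  apply/negP => /eqP s1; have := minn _ g0 rg.
  by rewrite leqNgt s1 irr.1.
have [p1 [c c0 pE] [r qE]] := dvdpP_rat_int pq.
(* As [q0] is monic, the leading coefficient of its integer factor [p1] is a unit, so [p1] can be
   made monic without leaving the integers. *)
have lc : lead_coef p1 * lead_coef r = 1.
  by rewrite -lead_coefM -qE (monicP mq0).
have u1 : lead_coef p1 \is a GRing.unit by apply/unitrPr; exists (lead_coef r).
have l0 : lead_coef p1 != 0 by apply: contraTneq u1 => ->; rewrite unitr0.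
pose e := (lead_coef p1)^-1.
have me : e *: p1 \is monic by rewrite monicE lead_coefZ mulVr.
have ppe : map_poly intr (e *: p1) %= p.
  rewrite pE eqp_sym (eqp_ltrans (eqp_scale _ c0)) map_polyZ.
  rewrite eqp_sym eqp_scale//.
  by rewrite intr_eq0 invr_eq0.
exists (e *: p1) => //; split.
- exact: mz.
- split; first by rewrite (eqp_size ppe) irr.1.
  move=> g g1 gp; rewrite (eqp_rtrans ppe); apply: irr.2 => //.
  by rewrite -(eqp_dvdr _ ppe).
- by rewrite -(eqp_root (_ : map_poly ratr p %= _))// eqp_map eqp_sym.
Qed.

(** * The complex modulus and the decay of the other conjugates *)

Lemma cmodE (R : realType) (z : R[i]) : `|z| = (cmod z)%:C.
Proof. by []. Qed.

Lemma cmod_real (R : realType) (x : R) : cmod x%:C = `|x|.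
Proof. by rewrite /cmod /= expr0n addr0 sqrtr_sqr. Qed.

Lemma cmod_ge0 (R : realType) (z : R[i]) : 0 <= cmod z.
Proof. by rewrite -lecR -cmodE normr_ge0. Qed.

Lemma cmodM (R : realType) (z w : R[i]) : cmod (z * w) = cmod z * cmod w.
Proof. exact: ComplexField.Normc.normcM. Qed.

Lemma cmod_prod (R : realType) (I : Type) (r : seq I) (F : I -> R[i]) :
  cmod (\prod_(i <- r) F i) = \prod_(i <- r) cmod (F i).
Proof.
apply: (big_morph (@cmod R) (@cmodM R)).
exact: ComplexField.Normc.normc1.
Qed.

Lemma cmodX (R : realType) (z : R[i]) n : cmod (z ^+ n) = cmod z ^+ n.
Proof. by rewrite -(card_ord n) -!prodr_const -!big_enum cmod_prod. Qed.

Lemma cmodD (R : realType) (z w : R[i]) : cmod (z + w) <= cmod z + cmod w.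
Proof. by rewrite -lecR -cmodE rmorphD /= -!cmodE ler_normD. Qed.

Lemma cmodB (R : realType) (z w : R[i]) : cmod z - cmod w <= cmod (z - w).
Proof. by rewrite lerBlDr; apply: le_trans (cmodD _ _); rewrite subrK. Qed.

Lemma cmod_sum (R : realType) (I : Type) (r : seq I) (F : I -> R[i]) :
  cmod (\sum_(i <- r) F i) <= \sum_(i <- r) cmod (F i).
Proof. by rewrite -lecR -cmodE rmorph_sum /=; exact: ler_norm_sum. Qed.

Lemma geometric_partial_sum_le (R : realType) (x : R) N : 0 <= x < 1 ->
  \sum_(j < N) x ^+ j <= (1 - x)^-1.
Proof.
move=> /andP[x0 x1]; rewrite -[leRHS]div1r ler_pdivlMr ?subr_gt0//.
have := subrX1 x N; rewrite mulrC => /(congr1 -%R).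
by rewrite -mulrN !opprB mulrC => <-; rewrite gerBl exprn_ge0.
Qed.

(** In characteristic zero the derivative is nonzero and of smaller degree, hence coprime to an
    irreducible [p]. This makes the conjugates distinct. *)
Lemma min_poly_separable (R : realType) (a : R) p :
  min_poly_over_rat a p -> separable_poly p.
Proof.
move=> [mp irr _]; have p0 : p != 0 by rewrite monic_neq0.
rewrite unlock irreducible_poly_coprime//.
apply/negP => /dvdp_leq; rewrite leqNgt lt_size_deriv// => H.
have : p^`() == 0 by apply: contraT => /H.
rewrite -size_poly_eq0 polyorder.size_deriv.
by case: irr; case: (size p) => [|[]].
Qed.

(* The nearby integer is the trace of [a ^+ j]; it differs from [a ^+ j] by the
   power sum of the other conjugates. *)
Lemma pisot_powers_near_integers (R : realType) (a : R) : pisot a ->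
  exists s : nat -> int, exists D : R,
    forall N, \sum_(j < N) `|a ^+ j - (s j)%:~R| <= D.
Proof.
move=> [a1 ia conj].
have [q mq pq] := min_poly_exists ia.
have [rs qE] := closed_field_poly_normal (map_poly intr q : {poly R[i]}).
have mqC : (map_poly intr q : {poly R[i]}) \is monic by exact: monic_map.
rewrite (monicP mqC) scale1r in qE.
have us : uniq rs.
  rewrite -separable_prod_XsubC -qE -map_poly_ratr_int separable_map.
  exact: min_poly_separable pq.
have ars : a%:C \in rs.
  rewrite -root_prod_XsubC -qE.
  have [_ _] := pq.
  rewrite -(fmorph_root (real_complex R)) -map_poly_comp -map_poly_comp.
  by rewrite (eq_map_poly (g := intr))// => x /=; rewrite ratr_int rmorph_int.
(* The roots being distinct, removing one occurrence of [a%:C] leaves only other conjugates, to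
   which the Pisot condition applies. *)
have cz (z : R[i]) : z \in rem a%:C rs -> 0 <= cmod z < 1.
  rewrite mem_rem_uniq// inE => /andP[za zr]; rewrite cmod_ge0/=.
  apply: conj => //; exists (map_poly intr q) => //.
  by rewrite map_poly_ratr_int qE root_prod_XsubC.
have /choice[s sE] : forall j, exists s : int, \sum_(z <- rs) z ^+ j = s%:~R.
  by move=> j; exact: int_power_sum mq qE.
(* Each remaining conjugate contributes a geometric series whose ratio is its modulus. *)
exists s, (\sum_(z <- rem a%:C rs) (1 - cmod z)^-1) => N.
have H j : `|a ^+ j - (s j)%:~R| <= \sum_(z <- rem a%:C rs) cmod z ^+ j.
  rewrite -cmod_real rmorphB rmorphXn /= rmorph_int -sE.
  rewrite (perm_big _ (perm_to_rem ars)) /=.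
  rewrite big_cons opprD addNKr -lecR -cmodE normrN cmodE lecR.
  apply: le_trans (cmod_sum _ _) _.
  by rewrite le_eqVlt; apply/orP; left; apply/eqP/eq_bigr => z _; exact: cmodX.
apply: (@le_trans _ _ (\sum_(j < N) \sum_(z <- rem a%:C rs) cmod z ^+ j)).
  by apply: ler_sum => j _.
rewrite exchange_big /= big_seq [X in _ <= X]big_seq; apply: ler_sum => z /cz.
exact: geometric_partial_sum_le.
Qed.

(** * Fourier transforms of self-similar measures *)

Lemma cexpiD (R : realType) (x y : R) : cexpi (x + y) = cexpi x * cexpi y.
Proof.
apply/eqP; rewrite eq_complex /= cosD sinD eqxx/=.
by rewrite addrC (mulrC (sin x)).
Qed.

Lemma cmod_cexpi (R : realType) (x : R) : cmod (cexpi x) = 1.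
Proof. by rewrite /cmod /= cos2Dsin2 sqrtr1. Qed.

Lemma measurable_sin (R : realType) : measurable_fun setT (@sin R).
Proof. exact: continuous_measurable_fun (@continuous_sin R). Qed.

Lemma measurable_cos (R : realType) : measurable_fun setT (@cos R).
Proof. exact: continuous_measurable_fun (@continuous_cos R). Qed.

Lemma measurable_phase (R : realType) (y : R * R) :
  measurable_fun setT (fun x : R * R => 2 * pi * dot2 y x).
Proof.
by apply: measurable_funM => //; apply: measurable_funD; apply: measurable_funM.
Qed.

Lemma integrable_le1 (R : realType) d (T : measurableType d)
    (mu : probability T R) (f : T -> R) :
    measurable_fun setT f -> (forall x, `|f x| <= 1) ->
  mu.-integrable setT (EFin \o f).
Proof.
move=> mf f1; apply: measurable_bounded_integrable => //.
  by rewrite (le_lt_trans (probability_le1 mu measurableT)) ?ltry.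
exists 1; split; first exact: num_real.
by move=> M M1 x _; apply: le_trans (f1 x) _; exact: ltW.
Qed.

(** Since [Cintegral] is built from two real integrals, the constant phase is pulled out by the
    addition formulas for [cos] and [sin]. *)
Lemma Cintegral_phase_shift (R : realType) d (T : measurableType d)
    (mu : probability T R) (theta : T -> R) (c : R) :
    measurable_fun setT theta ->
  Cintegral mu (fun x => cexpi (c + theta x)) =
  cexpi c * Cintegral mu (fun x => cexpi (theta x)).
Proof.
move=> mt.
have ic : mu.-integrable setT (EFin \o (cos \o theta)).
  apply: integrable_le1 => [|x]; last exact: cos_max.
  exact: measurableT_comp (@measurable_cos R) mt.
have is_ : mu.-integrable setT (EFin \o (sin \o theta)).
  apply: integrable_le1 => [|x]; last exact: sin_max.
  exact: measurableT_comp (@measurable_sin R) mt.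
have iZ a g : mu.-integrable setT (EFin \o g) ->
    mu.-integrable setT (EFin \o (fun x => a * g x)).
  move=> ig; apply: (eq_integrable _ (fun x => a%:E * (EFin \o g) x)%E) => //.
  exact: integrableZl.
apply/eqP; rewrite eq_complex /=; apply/andP; split; apply/eqP.
- under eq_Rintegral do rewrite cosD.
  by rewrite RintegralB ?RintegralZl//; exact: iZ.
- under eq_Rintegral do rewrite sinD.
  rewrite RintegralD ?RintegralZl//; [|exact: iZ|exact: iZ].
  by rewrite addrC.
Qed.

Lemma measurable_tau (R : realType) (lambda : R) (b : R * R) :
  measurable_fun setT (tau lambda b).
Proof.
apply/measurable_fun_pairP; split => /=; apply: measurable_funM => //;
  exact: measurable_funD.
Qed.

(** Lets the pushforward of [mu] under [tau lambda b] be formed as a [distribution]. *)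
HB.instance Definition _ (R : realType) (lambda : R) (b : R * R) :=
  isMeasurableFun.Build _ _ _ _ (tau lambda b) (measurable_tau lambda b).

Section hutchinson_integral.
Context (R : realType) (lambda : R) (B : seq (R * R)).
Context (mu : probability (R * R)%type R).
Hypothesis hmu : hutchinson lambda B mu.

Lemma hutchinson_digits_gt0 : (0 < size B)%N.
Proof.
rewrite lt0n; apply/eqP => /size0nil B0.
have := hmu (measurableT : measurable [set: R * R]).
rewrite B0 big_nil mule0 probability_setT => /eqP.
by rewrite onee_eq0.
Qed.

(** The Hutchinson equation identifies [mu] with a scaled sum of its pushforwards; each of these is
    integrated by change of variables. *)
Lemma ge0_integral_hutchinson (f : R * R -> \bar R) :
    measurable_fun setT f -> (forall x, 0 <= f x)%E ->
  (\int[mu]_x f x =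
    ((size B)%:R^-1)%:E * \sum_(b <- B) \int[mu]_x f (tau lambda b x))%E.
Proof.
move=> mf f0.
pose m_ n : measure (R * R)%type R := distribution mu (tau lambda (nth 0 B n)).
have k0 : 0 <= (size B)%:R^-1 :> R by rewrite invr_ge0 ler0n.
pose k : {nonneg R} := NngNum k0.
rewrite (eq_measure_integral (mscale k (msum m_ (size B)))); last first.
  by move=> A mA _; rewrite [LHS]hmu// (big_nth 0) big_mkord.
rewrite ge0_integral_mscale// ge0_integral_measure_sum//.
congr (_ * _)%E; rewrite (big_nth 0) big_mkord; apply: eq_bigr => i _.
by rewrite ge0_integral_distribution.
Qed.

Lemma Rintegral_hutchinson (f : R * R -> R) :
    measurable_fun setT f -> (forall x, `|f x| <= 1) ->
  \int[mu]_x f x =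
    (size B)%:R^-1 * \sum_(b <- B) \int[mu]_x f (tau lambda b x).
Proof.
move=> mf f1.
(* Adding [1] makes the integrand nonnegative. *)
have int (g : R * R -> R) : measurable_fun setT g -> (forall x, `|g x| <= 1) ->
    (\int[mu]_x (1 + g x)%:E = (1 + \int[mu]_x g x)%R%:E)%E.
  move=> mg g1; have ig := integrable_le1 mu mg g1.
  under eq_integral do rewrite EFinD.
  rewrite integralD//; last first.
    by apply: (@integrable_le1 _ _ _ mu (cst 1)) => // x; rewrite normr1.
  rewrite integral_cst// [X in (_ * X)%E](probability_setT mu) mule1.
  rewrite EFinD; congr (_ + _)%E.
  by rewrite fineK//; exact: integrable_fin_num.
have := @ge0_integral_hutchinson (fun x => (1 + f x)%:E) _ _.
rewrite int//.
under eq_bigr => b _.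
  rewrite int; last 2 first.
  - exact: measurableT_comp mf (measurable_tau lambda b).
  - by move=> x; exact: f1.
  over.
(* The added ones sum to [size B], which the weight cancels because [B] is nonempty. *)
rewrite sumEFin -EFinM big_split /= big_const_seq count_predT iter_addr_0.
rewrite mulrDr mulVf ?pnatr_eq0 -?lt0n ?hutchinson_digits_gt0//.
have H1 : measurable_fun setT (fun x : R * R => (1 + f x)%:E).
  by apply/measurable_EFinP; exact: measurable_funD.
have H2 x : (0 <= (1 + f x)%:E)%E.
  by rewrite lee_fin -lerBlDl sub0r; have /ler_normlP[] := f1 x; rewrite lerNl.
by move=> /(_ H1 H2) [] /addrI.
Qed.

Lemma Cintegral_hutchinson (f : R * R -> R[i]) :
    measurable_fun setT (fun x => complex.Re (f x)) ->
    measurable_fun setT (fun x => complex.Im (f x)) ->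
    (forall x, cmod (f x) <= 1) ->
  Cintegral mu f =
    (size B)%:R^-1 * \sum_(b <- B) Cintegral mu (fun x => f (tau lambda b x)).
Proof.
move=> mre mim f1.
have -> : (size B)%:R^-1 = ((size B)%:R^-1 : R)%:C :> R[i].
  by rewrite fmorphV rmorph_nat.
have sq x : complex.Re (f x) ^+ 2 + complex.Im (f x) ^+ 2 <= 1.
  rewrite -[leRHS](expr1n _ 2%N) -(@sqr_sqrtr _ (_ + _)) ?addr_ge0 ?sqr_ge0//.
  by rewrite ler_sqr ?nnegrE//; have := f1 x; rewrite /cmod; case: (f x).
have re1 x : `|complex.Re (f x)| <= 1.
  by rewrite -(@expr_le1 _ 2%N)// real_normK ?num_real//
    (le_trans _ (sq x))// lerDl sqr_ge0.
have im1 x : `|complex.Im (f x)| <= 1.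
  by rewrite -(@expr_le1 _ 2%N)// real_normK ?num_real//
    (le_trans _ (sq x))// lerDr sqr_ge0.
set S := \sum_(b <- B) _.
have SE : S = (\sum_(b <- B) \int[mu]_x complex.Re (f (tau lambda b x)))
           +i* (\sum_(b <- B) \int[mu]_x complex.Im (f (tau lambda b x))).
  rewrite {}/S; elim: (B) => [|b s IH]; first by rewrite !big_nil.
  by rewrite !big_cons IH.
rewrite SE /Cintegral (Rintegral_hutchinson mre re1).
rewrite (Rintegral_hutchinson mim im1).
by apply/eqP; rewrite eq_complex /= !mul0r subr0 addr0 !eqxx.
Qed.

(** The phase at [tau lambda b x] splits into a constant depending on [b] and the phase of the
    scaled frequency at [x], so all digits share one integral. *)
Lemma fourier_hutchinson (xi : R * R) :
  fourier mu xi =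
    (size B)%:R^-1 * (\sum_(b <- B) cexpi (2 * pi * (lambda * dot2 xi b)))
    * fourier mu (lambda * xi.1, lambda * xi.2).
Proof.
have mdot := @measurable_phase R.
rewrite /fourier Cintegral_hutchinson; last 3 first.
- exact: measurableT_comp (@measurable_cos R) (mdot xi).
- exact: measurableT_comp (@measurable_sin R) (mdot xi).
- by move=> x; rewrite cmod_cexpi.
rewrite -mulrA mulr_suml; congr (_ * _); apply: eq_bigr => b _.
rewrite -Cintegral_phase_shift//; congr Cintegral; apply/funext => x.
by congr cexpi; rewrite /dot2 /tau /=; ring.
Qed.

End hutchinson_integral.

(** * The mask and the tail of the product *)

Lemma cexpi_int (R : realType) (n : int) : cexpi (2 * pi * n%:~R) = 1 :> R[i].
Proof.
have nat_case (m : nat) : cexpi (2 * pi * m%:R) = 1 :> R[i].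
  rewrite mulr_natr (_ : 2 * pi *+ m = 0 + pi *+ 2 *+ m); last first.
    by rewrite add0r mulr_natl.
  by rewrite /cexpi (periodicn (@cosD2pi R)) (periodicn (@sinD2pi R)) cos0 sin0.
case: n => m; first exact: nat_case.
rewrite NegzE mulrNz mulrN.
have := cexpiD (2 * pi * m.+1%:R) (- (2 * pi * m.+1%:R) : R).
rewrite subrr nat_case mul1r => <-.
by rewrite /cexpi cos0 sin0.
Qed.

Lemma normr_sin_le (R : realType) (x : R) : `|sin x| <= `|x|.
Proof.
wlog x0 : x / 0 <= x.
  move=> H; have [/H//|/ltW x0] := leP 0 x.
  by rewrite -normrN -sinN -(normrN x); apply: H; rewrite oppr_ge0.
have [c _] := MVT_segment x0 (fun y _ => is_derive_sin y)
  (continuous_subspaceT (@continuous_sin R)).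
rewrite sin0 !subr0 => ->; rewrite normrM ler_piMl//; exact: cos_max.
Qed.

Lemma cmod_le_ReIm (R : realType) (z : R[i]) :
  cmod z <= `|complex.Re z| + `|complex.Im z|.
Proof.
rewrite {1}[z]complexE; apply: le_trans (cmodD _ _) _.
rewrite cmodM !cmod_real.
by rewrite (_ : cmod 'i = 1) ?mul1r// /cmod /= expr0n expr1n add0r sqrtr1.
Qed.

(** Real and imaginary parts are each at most [|x|] in absolute value; for the former, [1 - cos x =
    2 * sin (x / 2) ^+ 2 <= 2 * |sin (x / 2)|]. *)
Lemma cmod_1Bcexpi_le (R : realType) (x : R) : cmod (1 - cexpi x) <= 2 * `|x|.
Proof.
apply: le_trans (cmod_le_ReIm _) _; rewrite /= sub0r normrN.
have half : x = (x / 2) *+ 2 by rewrite -mulr_natr divfK// pnatr_eq0.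
have -> : 1 - cos x = 2 * sin (x / 2) ^+ 2.
  by rewrite [in LHS]half cos_mulr2n cos2sin2; ring.
have s1 := normr_sin_le (x / 2); have s2 := normr_sin_le x.
have s3 := sin_max (x / 2).
rewrite normrM normrX (ger0_norm (ler0n _ 2)).
have : `|x / 2| = `|x| / 2 by rewrite normrM normfV (ger0_norm (ler0n _ 2)).
have := normr_ge0 (sin (x / 2)); nra.
Qed.

(** The coefficient 2 arises because the digits [(1, 0)] and [(0, 1)] have equal phase on the
    diagonal. The argument is the angle, with [2 * pi] included. *)
Definition mask (R : realType) (t : R) : R[i] := 3^-1 * (1 + 2 * cexpi t).

Lemma cmod_mask (R : realType) (t : R) :
  cmod (mask t) = 3^-1 * cmod (1 + 2 * cexpi t).
Proof.
rewrite cmodM; congr (_ * _).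
by rewrite -(rmorph_nat (real_complex R)) -fmorphV cmod_real ger0_norm.
Qed.

Lemma cmod_nat (R : realType) (n : nat) : cmod (n%:R : R[i]) = n%:R :> R.
Proof. by rewrite -(rmorph_nat (real_complex R)) cmod_real ger0_norm. Qed.

Lemma cmod_mask_le1 (R : realType) (t : R) : cmod (mask t) <= 1.
Proof.
rewrite cmod_mask; have := cmodD 1 (2 * cexpi t).
by rewrite cmodM cmod_cexpi (cmod_nat R 1) (cmod_nat R 2); lra.
Qed.

Lemma cmod_mask_ge (R : realType) (t : R) : 3^-1 <= cmod (mask t).
Proof.
rewrite cmod_mask; have := cmodB (2 * cexpi t) (- 1).
rewrite opprK [2 * _ + 1]addrC cmodM cmod_cexpi (cmod_nat R 2).
have -> : cmod (-1 : R[i]) = 1 :> R.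
  by rewrite -(rmorphN1 (real_complex R)) cmod_real normrN1.
lra.
Qed.

(** The exponential form turns a product of masks into a sum of distances to integers. Close to [n]
    the bound is linear; farther away the lower bound [3^-1] takes over. *)
Lemma cmod_mask_near_int (R : realType) (x : R) (n : int) :
  expR (- (8 * pi * `|x - n%:~R|)) <= cmod (mask (2 * pi * x)).
Proof.
set u := `|x - n%:~R|; set f := cmod _.
have p0 := @pi_ge0 R; have u0 : 0 <= u by exact: normr_ge0.
(* Writing [1 + 2 * e = 3 - 2 * (1 - e)] with [cmod (1 - e) <= 2 * (2 * pi * u)] gives modulus at
   least [3 - 8 * pi * u], then divided by 3. *)
have f1 : 1 - 8 / 3 * pi * u <= f.
  have -> : f = 3^-1 * cmod (1 + 2 * cexpi (2 * pi * (x - n%:~R))).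
    by rewrite /f cmod_mask -{1}(subrK n%:~R x) mulrDr cexpiD cexpi_int mulr1.
  set e := cexpi _.
  have := cmod_1Bcexpi_le (2 * pi * (x - n%:~R)); rewrite -/e.
  rewrite [X in 2 * X]normrM ger0_norm ?mulr_ge0// -/u.
  have := cmodB 3 (2 * (1 - e)).
  rewrite (_ : 3 - 2 * (1 - e) = 1 + 2 * e); last by ring.
  by rewrite cmodM (cmod_nat R 2) (cmod_nat R 3); lra.
have f3 : 3^-1 <= f by exact: cmod_mask_ge.
have f0 : 0 < f by apply: lt_le_trans f3; rewrite invr_gt0.
have v0 : 0 <= pi * u by rewrite mulr_ge0.
rewrite expRN -[leRHS]invrK lef_pV2 ?posrE ?invr_gt0 ?expR_gt0//.
apply: le_trans (expR_ge1Dx _).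
(* [max (1 / 3) (1 - v) * (1 + 3 v) >= 1] with [v = 8 / 3 pi u], the threshold
   being [v = 2 / 3]. *)
rewrite -[f^-1]div1r ler_pdivrMr//.
have [h|h] := leP (8 * (pi * u)) 2; rewrite -[8 * pi * u]mulrA; last by nra.
move: f1; rewrite -[8 / 3 * pi * u]mulrA; nra.
Qed.

(** * Continuity of the Fourier transform at the origin *)

Lemma bounded_cvg_Rintegral (R : realType) d (T : measurableType d)
    (mu : probability T R) (f_ : nat -> T -> R) (f : T -> R) :
    (forall n, measurable_fun setT (f_ n)) -> measurable_fun setT f ->
    (forall n x, `|f_ n x| <= 1) -> (forall x, f_ n x @[n --> \oo] --> f x) ->
  \int[mu]_x f_ n x @[n --> \oo] --> \int[mu]_x f x.
Proof.
move=> mf_ mf f1 ff.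
have i1 : mu.-integrable setT (EFin \o cst 1).
  by apply: integrable_le1 => // x; rewrite normr1.
have [|||||fi _ H] := @dominated_convergence _ _ _ mu setT measurableT
  (fun n => EFin \o f_ n) (EFin \o f) (EFin \o cst 1).
- by move=> n; apply/measurable_EFinP.
- exact/measurable_EFinP.
- by apply: aeW => x _; apply: cvg_EFin; [exact: nearW|exact: ff].
- exact: i1.
- by apply: aeW => x n _; rewrite lee_fin.
apply: fine_cvg; rewrite fineK//; exact: integrable_fin_num.
Qed.

(** The phases tend to 0 pointwise, so by bounded convergence the integrals of [cos] and [sin] tend
    to 1 and 0. *)
Lemma cvg_fourier_0 (R : realType) (mu : probability (R * R)%type R)
    (u : nat -> R) :
    u n @[n --> \oo] --> (0 : R) ->
  cmod (1 - fourier_diag mu (u n)) @[n --> \oo] --> (0 : R).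
Proof.
move=> u0.
have mdot := @measurable_phase R.
pose t n (x : R * R) := 2 * pi * dot2 (u n, u n) x.
have t0 x : t n x @[n --> \oo] --> (0 : R).
  rewrite (_ : t ^~ x = fun n => u n * (2 * pi * (x.1 + x.2))); last first.
    by apply/funext => n; rewrite /t /dot2 /=; ring.
  by rewrite -(mul0r (2 * pi * (x.1 + x.2))); apply: cvgM => //; exact: cvg_cst.
have c1 : \int[mu]_x cos (t n x) @[n --> \oo] --> (1 : R).
  have -> : 1 = \int[mu]_x cst 1 x :> R.
    by rewrite Rintegral_cst// [X in fine X](probability_setT mu) mulr1.
  apply: bounded_cvg_Rintegral => //.
  - by move=> n; exact: measurableT_comp (@measurable_cos R) (mdot _).
  - by move=> n x; exact: cos_max.
  - move=> x; rewrite -(@cos0 R); apply: continuous_cvg (t0 x).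
    exact: continuous_cos.
have s0 : \int[mu]_x sin (t n x) @[n --> \oo] --> (0 : R).
  have -> : 0 = \int[mu]_x cst 0 x :> R by rewrite Rintegral_cst// mul0r.
  apply: bounded_cvg_Rintegral => //.
  - by move=> n; exact: measurableT_comp (@measurable_sin R) (mdot _).
  - by move=> n x; exact: sin_max.
  - move=> x; rewrite -(@sin0 R); apply: continuous_cvg (t0 x).
    exact: continuous_sin.
apply: (@squeeze_cvgr _ _ _ _ (cst 0)
  (fun n => `|1 - \int[mu]_x cos (t n x)| + `|- \int[mu]_x sin (t n x)|)).
- apply: nearW => n; apply/andP; split; first exact: cmod_ge0.
  by apply: le_trans (cmod_le_ReIm _) _; rewrite /= sub0r.
- exact: cvg_cst.
- have := cvgD (cvg_norm (cvgB (cvg_cst (1 : R)) c1)) (cvg_norm (cvgN s0)).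
  by rewrite subrr oppr0 normr0 addr0; exact.
Qed.

(** * The Sierpinski measure on the diagonal *)

Section sierpinski.
Context (R : realType) (lambda : R) (mu : probability (R * R)%type R).
Hypothesis hmu : hutchinson lambda (sierpinski_digits R) mu.

Lemma fourier_diag_rec (xi : R) :
  fourier_diag mu xi =
    mask (2 * pi * (lambda * xi)) * fourier_diag mu (lambda * xi).
Proof.
rewrite /fourier_diag (fourier_hutchinson hmu) /= /mask; congr (_ * _ * _).
rewrite !big_cons big_nil addr0 /dot2 /= !mulr0 !mulr1 !addr0 add0r mulr0.
by rewrite (cexpi_int R 0); ring.
Qed.

Lemma fourier_diag_iter (xi : R) (N : nat) :
  fourier_diag mu xi =
    (\prod_(1 <= n < N.+1) mask (2 * pi * (lambda ^+ n * xi)))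
    * fourier_diag mu (lambda ^+ N * xi).
Proof.
elim: N => [|N IH]; first by rewrite big_nil mul1r expr0 mul1r.
rewrite big_nat_recr//= -mulrA exprS -[lambda * _ * xi]mulrA.
by rewrite -fourier_diag_rec.
Qed.

Hypothesis lambda1 : 0 < lambda < 1.

Lemma cvg_fourier_diag_tail (xi : R) :
  cmod (1 - fourier_diag mu (lambda ^+ n * xi)) @[n --> \oo] --> (0 : R).
Proof.
apply: cvg_fourier_0.
have := @cvg_geometric R xi lambda.
rewrite gtr0_norm; last by case/andP: lambda1.
have /andP[_ ->] := lambda1; move=> /(_ isT); apply: cvg_trans.
by apply: near_eq_cvg; apply: nearW => n; rewrite /geometric /= mulrC.
Qed.

(** The error of the [N]-th partial product is that product, of modulus at most 1, times the
    deviation of the tail factor from 1. *)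
Lemma cvg_mask_prod (xi : R) :
  (fun N : nat =>
     \prod_(1 <= n < N.+1) mask (2 * pi * (lambda ^+ n * xi)) : R[i]^o)
    @ \oo --> (fourier_diag mu xi : R[i]^o).
Proof.
apply/cvgrPdist_lt => e e0.
(* The norm of [R[i]^o] is complex-valued, so [e] is complex; its positivity forces it to be
   real. *)
have [er ei] : 0 < complex.Re e /\ complex.Im e = 0.
  by move: e0; rewrite ltcE /= => /andP[/eqP].
have eE : e = (complex.Re e)%:C by apply/eqP; rewrite eq_complex /= ei !eqxx.
have /cvgrPdist_lt/(_ _ er) := cvg_fourier_diag_tail xi.
apply: filterS => N; rewrite sub0r normrN ger0_norm ?cmod_ge0// => H.
rewrite (fourier_diag_iter xi N).
set P := \prod_(_ <= _ < _) _; set F := fourier_diag _ _ in H *.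
rewrite -[X in _ - X]mulr1 -mulrBr -normrN -mulrN opprB eE cmodE ltcR.
apply: le_lt_trans H; rewrite cmodM ler_piMl ?cmod_ge0// cmod_prod.
by apply: numdomain.Num.Theory.prodr_ile1 => n _;
  rewrite cmod_ge0 cmod_mask_le1.
Qed.

Lemma cmod_mask_gt0 (t : R) : 0 < cmod (mask t).
Proof. by apply: lt_le_trans (cmod_mask_ge t); rewrite invr_gt0. Qed.

(** For some [N] the tail factor lies within distance less than 1 of 1, hence is nonzero; the
    finitely many masks before it are nonzero too. *)
Lemma cmod_fourier_diag_gt0 (xi : R) : 0 < cmod (fourier_diag mu xi).
Proof.
have /cvgrPdist_lt/(_ _ ltr01) := cvg_fourier_diag_tail xi.
move=> [N _ /(_ N (leqnn N))].
rewrite sub0r normrN ger0_norm ?cmod_ge0// => H.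
rewrite (fourier_diag_iter xi N) cmodM cmod_prod mulr_gt0//.
  by apply: prodr_gt0 => n _; exact: cmod_mask_gt0.
have := cmodB 1 (1 - fourier_diag mu (lambda ^+ N * xi)).
by rewrite subKr (cmod_nat R 1); apply: lt_le_trans; rewrite subr_gt0.
Qed.

Lemma fourier_diag_powers (k : nat) :
  fourier_diag mu (lambda^-1 ^+ k) =
    (\prod_(j < k) mask (2 * pi * lambda^-1 ^+ j)) * fourier_diag mu 1.
Proof.
elim: k => [|k IH]; first by rewrite big_ord0 mul1r.
have E : lambda * lambda^-1 ^+ k.+1 = lambda^-1 ^+ k.
  by rewrite exprS mulVKf//; case/andP: lambda1 => /gt_eqF->.
by rewrite fourier_diag_rec E IH big_ord_recr mulrCA mulrA.
Qed.

End sierpinski.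

Theorem theorem4p1 (R : realType) (alpha lambda : R)
    (mu : probability (R * R)%type R)
    (Halpha : pisot alpha)
    (Hlambda : lambda = alpha^-1)
    (Hmu : hutchinson lambda (sierpinski_digits R) mu) :
  [/\ forall xi : R,
        (fun N : nat =>
           \prod_(1 <= n < N.+1)
             (3^-1 * (1 + 2 * cexpi (2 * pi * (lambda ^+ n * xi)))) : R[i]^o)
          @ \oo --> (fourier_diag mu xi : R[i]^o),
      exists2 C : R, 0 < C &
        forall k : nat, C <= cmod (fourier_diag mu (alpha ^+ k))
    & ~ ((fun k : nat => cmod (fourier_diag mu (alpha ^+ k))) @ \oo
           --> (0 : R))].
Proof.
have alpha1 : 1 < alpha by case: Halpha.
have lambda1 : 0 < lambda < 1.
  by rewrite Hlambda invr_gt0 invf_lt1 ?(lt_trans ltr01 alpha1)//= alpha1.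
have alphaE : alpha = lambda^-1 by rewrite Hlambda invrK.
have [C C0 HC] : exists2 C : R, 0 < C &
    forall k : nat, C <= cmod (fourier_diag mu (alpha ^+ k)).
  have [s [D HD]] := pisot_powers_near_integers Halpha.
  (* The exponential bounds the product of the masks at the powers of [alpha] for every [k], as [D]
     bounds all partial sums of distances; the other factor is the value at [xi = 1]. *)
  exists (expR (- (8 * pi * D)) * cmod (fourier_diag mu 1)).
    by rewrite mulr_gt0 ?expR_gt0// (cmod_fourier_diag_gt0 Hmu lambda1).
  move=> k; rewrite alphaE (fourier_diag_powers Hmu lambda1) cmodM.
  rewrite ler_wpM2r ?cmod_ge0// cmod_prod -alphaE.
  apply: (@le_trans _ _
    (\prod_(j < k) expR (- (8 * pi * `|alpha ^+ j - (s j)%:~R|)))).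
    rewrite -expR_sum ler_expR sumrN lerN2 -mulr_sumr ler_wpM2l//.
    by rewrite mulr_ge0// pi_ge0.
  by apply: ler_prod => j _; rewrite expR_ge0 cmod_mask_near_int.
split; [exact: cvg_mask_prod Hmu lambda1|by exists C|].
move=> /cvgrPdist_lt/(_ _ C0)[N _ /(_ N (leqnn N))].
by rewrite sub0r normrN ger0_norm ?cmod_ge0// ltNge HC.
Qed.
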